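(* Let $X$ be a complex analytic space of dimension $n$, and let $f:X\to\mathbf{C}$ be a holomorphic function such that, for $t\neq 0$, the fibers $f^{-1}(t)$ are smooth and purely $(n-1)$-dimensional, and such that $f$ is nonconstant on every $n$-dimensional irreducible component of $X$. Put $Y=f^{-1}(0)$, and assume $X\setminus Y$ is smooth and purely $n$-dimensional. Let $V_{\bullet}=\bigoplus_k V_k$, $V_k=\mathrm{Gr}^W_k\varphi_{f,1}{}^p\mathcal{H}^0(\mathbf{Q}_X[n])$, let $V_\bullet\cong V'_\bullet\oplus V''_\bullet$ be the decomposition described in the context, and let $K'_k=\mathrm{Ker}\,N\cap V'_k$, $K''_k=\mathrm{Ker}\,N\cap V''_k$. For $k\ge 0$ let $P'_{n+k}:=\mathrm{Ker}\,N^{k+1}\subset V'_{n+k}$ and $P''_{n-1+k}:=\mathrm{Ker}\,N^{k+1}\subset V''_{n-1+k}$ be the $N$-primitive parts. Then we have the Lefschetz decompositions $$V'_{\bullet}=\bigoplus_{k\ge 0}\bigoplus_{i=0}^k N^iP'_{n+k}(i),\qquad V''_{\bullet}=\bigoplus_{k\ge 0}\bigoplus_{i=0}^k N^iP''_{n-1+k}(i),$$ with $$K'_{n-k}=N^kP'_{n+k}(k),\qquad K''_{n-1-k}=N^kP''_{n-1+k}(k).$$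
   Context: $\mathrm{MHM}(X)$ denotes Saito's abelian category of mixed Hodge modules on $X$, with its canonical weight filtration $W$; mixed Hodge modules are denoted by their underlying rational perverse sheaves. ${}^p\mathcal{H}^j$ denotes perverse cohomology, taken in mixed Hodge modules, and $(m)$ denotes the Tate twist. Throughout, $X$ is assumed (shrinking it if necessary) to be an intersection of hypersurfaces in a complex manifold, so that $\mathbf{Q}_X$ is defined in $D^b\mathrm{MHM}(X)$. $\psi_f,\varphi_f$ are Deligne's nearby and vanishing cycle functors, shifted by $-1$ so that they preserve perverse sheaves (and mixed Hodge modules) and commute with ${}^p\mathcal{H}^j$; $\varphi_{f,1}$ is the unipotent monodromy part of $\varphi_f$. $N=\log T_u$, where $T_u$ is the unipotent part of the monodromy $T$; it induces $N:V_k\to V_{k-2}(-1)$. The decomposition: there is a (noncanonical) decomposition $V_\bullet\cong V'_\bullet\oplus V''_\bullet$ of graded objects in $\mathrm{MHM}(Y)$, compatible with $N$, such that for $i>0$ one has $N^i:V'_{n+i}\xrightarrow{\sim}V'_{n-i}(-i)$ and $N^i:V''_{n-1+i}\xrightarrow{\sim}V''_{n-1-i}(-i)$, and such that $K'_k=(\mathrm{Gr}^W_{k-2}({}^p\mathcal{H}^{n-1}\mathbf{Q}_Y/{}^p\mathcal{H}^{n-1}\mathbf{Q}_X))(-1)$ for $k\le n$ and $K''_k=\mathrm{Gr}^W_k{}^p\mathcal{H}^n\mathbf{Q}_X$ for $k\le n-1$ (here ${}^p\mathcal{H}^{n-1}\mathbf{Q}_X$, which is supported in $Y$, is a submodule of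 ${}^p\mathcal{H}^{n-1}\mathbf{Q}_Y$ via restriction). *)

(* Defs.v *)
From HB Require Import structures.
From mathcomp Require Import all_boot all_order all_algebra complex.
From mathcomp Require Import all_classical all_reals all_analysis.
Set Implicit Arguments.
Unset Strict Implicit.
Unset Printing Implicit Defensive.
Import Order.TTheory GRing.Theory Num.Theory.
Import numFieldNormedType.Exports.
Local Open Scope classical_set_scope.
Local Open Scope ring_scope.

(** * Q-linear and abelian categories *)

Record category := Category {
  obj :> Type;
  Mor : obj -> obj -> lmodType rat;
  idm : forall a, Mor a a;
  comp : forall a b c, Mor b c -> Mor a b -> Mor a c;
  comp1m : forall a b (f : Mor a b), comp (idm b) f = f;
  compm1 : forall a b (f : Mor a b), comp f (idm a) = f;
  compA : forall a b c d (h : Mor c d) (g : Mor b c) (f : Mor a b),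
    comp h (comp g f) = comp (comp h g) f;
  comp_linl : forall a b c (f : Mor a b) (q : rat) (g g' : Mor b c),
    comp (q *: g + g') f = q *: comp g f + comp g' f;
  comp_linr : forall a b c (g : Mor b c) (q : rat) (f f' : Mor a b),
    comp g (q *: f + f') = q *: comp g f + comp g f'
}.
Arguments Mor {_} _ _.
Arguments idm {_} _.
Arguments comp {_ _ _ _} _ _.

Notation "g \oc f" := (comp g f) (at level 40, left associativity).

Section CategoryNotions.
Variable C : category.
Implicit Types a b c z : C.

Definition is_zero a : Prop := idm a = 0.

Definition is_mono a b (f : Mor a b) : Prop :=
  forall z (g h : Mor z a), f \oc g = f \oc h -> g = h.

Definition is_epi a b (f : Mor a b) : Prop :=
  forall z (g h : Mor b z), g \oc f = h \oc f -> g = h.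

Definition is_iso a b (f : Mor a b) : Prop :=
  exists g : Mor b a, g \oc f = idm a /\ f \oc g = idm b.

Definition isomorphic a b : Prop := exists f : Mor a b, is_iso f.

Definition is_kernel k a b (i : Mor k a) (f : Mor a b) : Prop :=
  f \oc i = 0 /\
  forall z (g : Mor z a), f \oc g = 0 -> exists! h : Mor z k, i \oc h = g.

Definition is_cokernel a b q (p : Mor b q) (f : Mor a b) : Prop :=
  p \oc f = 0 /\
  forall z (g : Mor b z), g \oc f = 0 -> exists! h : Mor q z, h \oc p = g.

Definition is_coproduct (I : Type) (s : I -> C) b (u : forall i, Mor (s i) b)
    : Prop :=
  forall z (g : forall i, Mor (s i) z),
    exists! h : Mor b z, forall i, h \oc u i = g i.

Definition is_biproduct a b c (i : Mor a c) (j : Mor b c) : Prop :=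
  exists (p : Mor c a) (q : Mor c b),
    [/\ p \oc i = idm a, q \oc j = idm b, p \oc j = 0, q \oc i = 0
      & i \oc p + j \oc q = idm c].

(* Equality of the subobjects of [c] represented by [i] and [j]. *)
Definition same_subobject a b c (i : Mor a c) (j : Mor b c) : Prop :=
  exists2 u : Mor a b, is_iso u & j \oc u = i.

Fixpoint epow a (f : Mor a a) (m : nat) : Mor a a :=
  if m is m'.+1 then f \oc epow f m' else idm a.

(* log t = \sum_{j >= 1} (-1)^(j-1) (t - 1)^j / j, truncated at j = m; it is
   the logarithm of [t] as soon as (t - 1)^m = 0. *)
Definition log_trunc a (t : Mor a a) (m : nat) : Mor a a :=
  \sum_(j < m) ((-1) ^+ j / j.+1%:R : rat) *: epow (t - idm a) j.+1.

Definition transport (I : Type) (V : I -> C) (j k : I) (e : j = k) :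
    Mor (V j) (V k) :=
  match e in _ = k' return Mor (V j) (V k') with erefl => idm (V j) end.

End CategoryNotions.

Record abcat := AbCat {
  abcat_cat :> category;
  ab_zero : exists z : abcat_cat, is_zero z;
  ab_biproduct : forall a b : abcat_cat,
    exists (c : abcat_cat) (i : Mor a c) (j : Mor b c), is_biproduct i j;
  Ker : forall a b : abcat_cat, Mor a b -> abcat_cat;
  kerm : forall (a b : abcat_cat) (f : Mor a b), Mor (Ker f) a;
  kermP : forall (a b : abcat_cat) (f : Mor a b), is_kernel (kerm f) f;
  Coker : forall a b : abcat_cat, Mor a b -> abcat_cat;
  cokerm : forall (a b : abcat_cat) (f : Mor a b), Mor b (Coker f);
  cokermP : forall (a b : abcat_cat) (f : Mor a b), is_cokernel (cokerm f) f;
  mono_normal : forall (a b : abcat_cat) (f : Mor a b), is_mono f ->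
    exists (c : abcat_cat) (g : Mor b c), is_kernel f g;
  epi_normal : forall (a b : abcat_cat) (f : Mor a b), is_epi f ->
    exists (c : abcat_cat) (g : Mor c a), is_cokernel f g
}.
Arguments Ker {_ _ _} _.
Arguments kerm {_ _ _} _.
Arguments Coker {_ _ _} _.
Arguments cokerm {_ _ _} _.

Definition Im (A : abcat) (a b : A) (f : Mor a b) : A := Ker (cokerm f).
Definition imm (A : abcat) (a b : A) (f : Mor a b) : Mor (Im f) b :=
  kerm (cokerm f).

Record functor (C D : category) := Functor {
  fobj :> C -> D;
  fmap : forall a b : C, Mor a b -> Mor (fobj a) (fobj b);
  fmap1 : forall a, fmap (idm a) = idm (fobj a);
  fmapM : forall (a b c : C) (g : Mor b c) (f : Mor a b),
    fmap (g \oc f) = fmap g \oc fmap f;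
  fmap_lin : forall (a b : C) (q : rat) (f g : Mor a b),
    fmap (q *: f + g) = q *: fmap f + fmap g
}.
Arguments fmap {_ _} _ {_ _} _.

Definition exact_functor (A B : category) (F : functor A B) : Prop :=
  (forall (k a b : A) (i : Mor k a) (f : Mor a b),
     is_kernel i f -> is_kernel (fmap F i) (fmap F f)) /\
  (forall (a b q : A) (p : Mor b q) (f : Mor a b),
     is_cokernel p f -> is_cokernel (fmap F p) (fmap F f)).

Definition faithful (A B : category) (F : functor A B) : Prop :=
  forall (a b : A) (f g : Mor a b), fmap F f = fmap F g -> f = g.

Definition fully_faithful (A B : category) (F : functor A B) : Prop :=
  faithful F /\
  forall (a b : A) (g : Mor (F a) (F b)), exists f : Mor a b, fmap F f = g.

(* The two sides of a natural transformation are given as functions on objects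
   and arrows, so that composites of functors need not be packaged. *)
Definition natural (C D : category) (F G : C -> D)
    (Fm : forall a b : C, Mor a b -> Mor (F a) (F b))
    (Gm : forall a b : C, Mor a b -> Mor (G a) (G b))
    (t : forall a, Mor (F a) (G a)) : Prop :=
  forall (a b : C) (f : Mor a b), t b \oc Fm a b f = Gm a b f \oc t a.

(** * Tate twists, and graded objects with a map N : V_k -> V_{k-2}(-1) *)

Record tate_twist (A : category) := TateTwist {
  tw_neg : functor A A;
  tw_pos : functor A A;
  tw_pn : forall M : A, Mor (tw_pos (tw_neg M)) M;
  tw_pn_iso : forall M, is_iso (tw_pn M);
  tw_pn_nat : natural (fun _ _ f => fmap tw_pos (fmap tw_neg f))
                      (fun _ _ f => f) tw_pn;
  tw_np : forall M : A, Mor (tw_neg (tw_pos M)) M;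
  tw_np_iso : forall M, is_iso (tw_np M);
  tw_np_nat : natural (fun _ _ f => fmap tw_neg (fmap tw_pos f))
                      (fun _ _ f => f) tw_np
}.

Section Lefschetz.
Variables (A : abcat) (T : tate_twist A).

(* M(-i) *)
Fixpoint twn (i : nat) (M : A) : A :=
  if i is i'.+1 then tw_neg T (twn i' M) else M.

(* M(i) *)
Fixpoint twp (i : nat) (M : A) : A :=
  if i is i'.+1 then twp i' (tw_pos T M) else M.

Fixpoint twp_map (i : nat) : forall M M' : A,
    Mor M M' -> Mor (twp i M) (twp i M') :=
  match i return forall M M' : A, Mor M M' -> Mor (twp i M) (twp i M') with
  | 0 => fun _ _ f => f
  | i'.+1 => fun _ _ f => twp_map i' (fmap (tw_pos T) f)
  end.

(* The canonical isomorphism M(-i)(i) -> M. *)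
Fixpoint untwist (i : nat) (M : A) : Mor (twp i (twn i M)) M :=
  match i return Mor (twp i (twn i M)) M with
  | 0 => idm M
  | i'.+1 => untwist i' M \oc twp_map i' (tw_pn T (twn i' M))
  end.

Record Ngraded := NGraded {
  gr :> int -> A;
  gN : forall k : int, Mor (gr k) (tw_neg T (gr (k - 2)))
}.

Lemma shift_step (k j : int) (i : nat) :
  k - (i.+1).*2%:Z = j -> k - 2 - i.*2%:Z = j.
Proof. by move=> <-; rewrite doubleS -addrA -opprD. Qed.

(* N^i : V_k -> V_j(-i), where j = k - 2i. *)
Fixpoint Npow (V : Ngraded) (i : nat) : forall k j : int,
    k - i.*2%:Z = j -> Mor (V k) (twn i (V j)) :=
  match i return forall k j : int, k - i.*2%:Z = j -> Mor (V k) (twn i (V j))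
  with
  | 0 => fun k j e => transport V (etrans (esym (subr0 k)) e)
  | i'.+1 => fun k j e => fmap (tw_neg T) (Npow V (shift_step e)) \oc gN V k
  end.

(* Ker N \cap V_k *)
Definition KerN (V : Ngraded) (k : int) : A := Ker (gN V k).
Definition KerN_incl (V : Ngraded) (k : int) : Mor (KerN V k) (V k) :=
  kerm (gN V k).

(* P_{c+k} = Ker N^{k+1} \subset V_{c+k} *)
Definition Prim (V : Ngraded) (c : int) (k : nat) : A :=
  Ker (@Npow V k.+1 (c + k%:Z) _ erefl).
Definition Prim_incl (V : Ngraded) (c : int) (k : nat) :
    Mor (Prim V c k) (V (c + k%:Z)) :=
  kerm (@Npow V k.+1 (c + k%:Z) _ erefl).

(* N^i P_{c+k}(i) \subset V_j, for j = c + k - 2i: the image of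
   P_{c+k}(i) -> V_{c+k}(i) -> V_j(-i)(i) = V_j. *)
Definition NPrim_map (V : Ngraded) (c : int) (k i : nat) (j : int)
    (e : c + k%:Z - i.*2%:Z = j) : Mor (twp i (Prim V c k)) (V j) :=
  untwist i (V j) \oc twp_map i (Npow V e \oc Prim_incl V c k).
Definition NPrim V c k i j e : A := Im (@NPrim_map V c k i j e).
Definition NPrim_incl V c k i j e : Mor (@NPrim V c k i j e) (V j) :=
  imm (@NPrim_map V c k i j e).

(* The pairs (k, i) with 0 <= i <= k for which N^i P_{c+k}(i) has degree j. *)
Record lefschetz_index (c j : int) := LefschetzIndex {
  lk : nat;
  li : nat;
  li_le : (li <= lk)%N;
  l_deg : c + lk%:Z - li.*2%:Z = j
}.

(* V = \bigoplus_{k >= 0} \bigoplus_{0 <= i <= k} N^i P_{c+k}(i) as an internal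
   direct sum of graded subobjects, i.e. in each degree j. *)
Definition lefschetz_decomposition (V : Ngraded) (c : int) : Prop :=
  forall j : int,
    is_coproduct (fun p : lefschetz_index c j => NPrim_incl V (l_deg p)).

Lemma sub_double (c : int) (k : nat) : c + k%:Z - k.*2%:Z = c - k%:Z.
Proof. by rewrite -addnn PoszD opprD addrA addrK. Qed.

(* N^i : V_{c+i} -> V_{c-i}(-i) is an isomorphism for all i > 0. *)
Definition hard_lefschetz (V : Ngraded) (c : int) : Prop :=
  forall i : nat, (0 < i)%N -> is_iso (Npow V (sub_double c i)).

(* V = V' \oplus V'' as graded objects, compatibly with N. *)
Definition N_direct_sum (V V' V'' : Ngraded) : Prop :=
  exists (u' : forall k, Mor (V' k) (V k)) (u'' : forall k, Mor (V'' k) (V k)),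
  forall k,
  [/\ is_biproduct (u' k) (u'' k),
      gN V k \oc u' k = fmap (tw_neg T) (u' (k - 2)) \oc gN V' k
    & gN V k \oc u'' k = fmap (tw_neg T) (u'' (k - 2)) \oc gN V'' k].

End Lefschetz.

(** * Complex analytic spaces *)

Section Analytic.
Variable R : realType.

Definition CC : normedModType R[i] := R[i]^o.
Definition Cn (N : nat) : normedModType R[i] := 'rV[R[i]]_N.

Definition holomorphic_on N (D : set (Cn N)) (F : Cn N -> CC) : Prop :=
  open D /\ forall z, D z -> differentiable F z.

(* A space with a sheaf of C-valued functions: [hol U g] says that g is a
   section over the open set U; the values of g outside U are irrelevant. *)
Record fspace := FSpace {
  carrier :> topologicalType;
  hol : set carrier -> (carrier -> CC) -> Prop
}.

(* Local models: common zeros of finitely many holomorphic functions. *)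
Definition local_model N (A : set (Cn N)) : Prop :=
  exists (D : set (Cn N)) (m : nat) (g : 'I_m -> Cn N -> CC),
    [/\ open D, forall i, holomorphic_on D (g i)
      & A = [set z | D z /\ forall i, g i z = 0]].

(* phi identifies the open subset U of X, with its sheaf of functions, with the
   subset A of C^N, with the functions that are locally restrictions of
   holomorphic functions on C^N. *)
Definition is_chart (X : fspace) (U : set X) N (phi : X -> Cn N)
    (A : set (Cn N)) : Prop :=
  [/\ open U, phi @` U = A, {in U &, injective phi},
      forall V, V `<=` U ->
        (open V <-> exists W, open W /\ phi @` V = A `&` W)
    & forall V (g : X -> CC), open V -> V `<=` U ->
        (hol V g <-> forall x, V x -> exists (W : set (Cn N)) (F : Cn N -> CC),
            [/\ holomorphic_on W F, W (phi x)
              & forall y, V y -> W (phi y) -> g y = F (phi y)])].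

Definition is_complex_space (X : fspace) : Prop :=
  [/\ hausdorff_space X,
      forall (U : set X) g, hol U g -> open U,
      forall (U : set X) g, open U ->
        (hol U g <-> forall x, U x -> exists V, [/\ V x, V `<=` U & hol V g])
    & forall x : X, exists (U : set X) N (phi : X -> Cn N) A,
        [/\ U x, local_model A & is_chart U phi A]].

(* Complex analytic spaces are taken reduced: MHM(X), Q_X and the functors
   below depend only on the reduction of X. *)
Record cspace := CSpace {
  cspace_fspace :> fspace;
  cspaceP : is_complex_space cspace_fspace
}.

Record holfun (X : cspace) := HolFun {
  holfun_fun :> X -> CC;
  holfunP : hol setT holfun_fun
}.

(* A subset with the induced topology and the functions that extend locally to
   the ambient space. *)
Definition induced_space (X : fspace) (A : set X) : fspace :=
  FSpace (carrier := A : topologicalType) (fun U g =>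
    open U /\ forall x, U x -> exists (V : set X) (G : X -> CC),
      [/\ V (set_val x), hol V G
        & forall y, U y -> V (set_val y) -> g y = G (set_val y)]).

Definition fiber (X : fspace) (f : X -> CC) (t : CC) : fspace :=
  induced_space [set x | f x = t].

Definition smooth_at (X : fspace) (d : nat) (x : X) : Prop :=
  exists (U : set X) (phi : X -> Cn d) (A : set (Cn d)),
    [/\ U x, open A & is_chart U phi A].

Definition smooth_pure (X : fspace) (d : nat) : Prop :=
  forall x : X, smooth_at d x.

Definition regular_locus (X : fspace) : set X :=
  [set x | exists d, smooth_at d x].

Definition has_dim (X : fspace) (n : nat) : Prop :=
  (exists x : X, smooth_at n x) /\
  forall (x : X) d, smooth_at d x -> (d <= n)%N.

(* The irreducible components of a reduced space are the closures of the
   connected components of its regular locus. *)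
Definition irreducible_component (X : fspace) (d : nat) (Z : set X) : Prop :=
  exists x : X, smooth_at d x /\
    Z = closure (connected_component (@regular_locus X) x).

Definition hypersurface (M : fspace) (H : set M) : Prop :=
  [/\ closed H, interior H = set0
    & forall x : M, exists (U : set M) (h : M -> CC),
        [/\ U x, hol U h & forall y, U y -> (H y <-> h y = 0)]].

Definition isomorphic_spaces (X Y : fspace) : Prop :=
  exists (u : X -> Y) (v : Y -> X),
    [/\ cancel u v, cancel v u, continuous u, continuous v
      & forall (U : set X) (g : X -> CC), open U ->
          (hol U g <-> hol (v @^-1` U) (g \o v))].

Definition intersection_of_hypersurfaces (X : fspace) : Prop :=
  exists (M : cspace) (m : nat) (H : 'I_m -> set M),
    [/\ @regular_locus M = setT, forall i, hypersurface (H i)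
      & isomorphic_spaces X (@induced_space M [set x | forall i, H i x])].

End Analytic.

(** * Mixed Hodge modules

  The categories and functors of Saito's theory that enter the statement, with
  the properties that fix their meaning relative to one another; this is an
  interface, not a construction of the theory, and an inhabitant need not be
  Saito's.  The categories are indexed by all function spaces so that
  Y = f^{-1}(0) can be used as an index directly; their values at spaces which
  are not complex analytic play no role. *)

Record mhm_theory (R : realType) := MHMTheory {
  MHM : fspace R -> abcat;

  (* Rational perverse sheaves, and the underlying perverse sheaf. *)
  Perv : fspace R -> abcat;
  rat_of : forall X, functor (MHM X) (Perv X);
  rat_exact : forall X, exact_functor (rat_of X);
  rat_faithful : forall X, faithful (rat_of X);

  (* Tate twists; 2 pi i trivializes the twist on perverse sheaves. *)
  tate : forall X, tate_twist (MHM X);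
  rat_tw : forall X (M : MHM X),
    Mor (rat_of X (tw_neg (tate X) M)) (rat_of X M);
  rat_tw_iso : forall X (M : MHM X), is_iso (rat_tw M);
  rat_tw_nat : forall X,
    natural (fun _ _ f => fmap (rat_of X) (fmap (tw_neg (tate X)) f))
            (fun _ _ f => fmap (rat_of X) f) (@rat_tw X);

  (* The weight filtration: finite, functorial and exact (strictness), with
     W_k(M(-1)) = (W_{k-2} M)(-1). *)
  W : forall X, int -> functor (MHM X) (MHM X);
  W_incl : forall X k (M : MHM X), Mor (W X k M) M;
  W_incl_mono : forall X k (M : MHM X), is_mono (W_incl k M);
  W_incl_nat : forall X k,
    natural (fun _ _ f => fmap (W X k) f) (fun _ _ f => f) (@W_incl X k);
  W_step : forall X k (M : MHM X), Mor (W X (k - 1) M) (W X k M);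
  W_stepE : forall X k (M : MHM X),
    W_incl k M \oc W_step k M = W_incl (k - 1) M;
  W_exact : forall X k, exact_functor (W X k);
  W_finite : forall X (M : MHM X), exists a b : int,
    (forall k, k < a -> is_zero (W X k M)) /\
    (forall k, b <= k -> is_iso (W_incl k M));
  W_tw : forall X k (M : MHM X),
    Mor (W X k (tw_neg (tate X) M)) (tw_neg (tate X) (W X (k - 2) M));
  W_tw_iso : forall X k (M : MHM X), is_iso (W_tw k M);
  W_twE : forall X k (M : MHM X),
    fmap (tw_neg (tate X)) (W_incl (k - 2) M) \oc W_tw k M =
    W_incl k (tw_neg (tate X) M);

  (* The derived category, its shift K |-> K[1] and perverse cohomology. *)
  Db : fspace R -> category;
  shift : forall X, functor (Db X) (Db X);
  pH : forall X, int -> functor (Db X) (MHM X);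
  pH_shift : forall X j (K : Db X), Mor (pH X j (shift X K)) (pH X (j + 1) K);
  pH_shift_iso : forall X j (K : Db X), is_iso (pH_shift j K);
  pH_shift_nat : forall X j,
    natural (fun _ _ f => fmap (pH X j) (fmap (shift X) f))
            (fun _ _ f => fmap (pH X (j + 1)) f) (@pH_shift X j);

  (* The constant object Q_X. *)
  QQ : forall X, Db X;

  (* Direct image by the closed embedding of f^{-1}(0), and the restriction
     morphism Q_X -> i_* Q_Y. *)
  push : forall (X : cspace R) (f : holfun X),
    functor (MHM (fiber f 0)) (MHM X);
  push_exact : forall (X : cspace R) (f : holfun X), exact_functor (push f);
  push_ff : forall (X : cspace R) (f : holfun X), fully_faithful (push f);
  pushD : forall (X : cspace R) (f : holfun X),
    functor (Db (fiber f 0)) (Db X);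
  pH_push : forall (X : cspace R) (f : holfun X) j (K : Db (fiber f 0)),
    Mor (pH X j (pushD f K)) (push f (pH (fiber f 0) j K));
  pH_push_iso : forall (X : cspace R) (f : holfun X) j K,
    is_iso (@pH_push X f j K);
  pH_push_nat : forall (X : cspace R) (f : holfun X) j,
    natural (fun _ _ g => fmap (pH X j) (fmap (pushD f) g))
            (fun _ _ g => fmap (push f) (fmap (pH (fiber f 0) j) g))
            (@pH_push X f j);
  restr : forall (X : cspace R) (f : holfun X),
    Mor (QQ X) (pushD f (QQ (fiber f 0)));

  (* Vanishing cycles, shifted by -1 so as to be exact on mixed Hodge modules;
     the monodromy acts on the underlying perverse sheaf only. *)
  phi : forall (X : cspace R) (f : holfun X),
    functor (MHM X) (MHM (fiber f 0));
  phi_exact : forall (X : cspace R) (f : holfun X), exact_functor (phi f);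
  mono_T : forall (X : cspace R) (f : holfun X) (M : MHM X),
    Mor (rat_of (fiber f 0) (phi f M)) (rat_of (fiber f 0) (phi f M));
  mono_T_iso : forall (X : cspace R) (f : holfun X) (M : MHM X),
    is_iso (mono_T f M);
  mono_T_nat : forall (X : cspace R) (f : holfun X),
    natural (fun _ _ g => fmap (rat_of (fiber f 0)) (fmap (phi f) g))
            (fun _ _ g => fmap (rat_of (fiber f 0)) (fmap (phi f) g))
            (@mono_T X f);

  (* phi_{f,1} = Ker (T - 1)^m for m >> 0. *)
  phi1 : forall (X : cspace R) (f : holfun X),
    functor (MHM X) (MHM (fiber f 0));
  phi1_incl : forall (X : cspace R) (f : holfun X) (M : MHM X),
    Mor (phi1 f M) (phi f M);
  phi1_incl_nat : forall (X : cspace R) (f : holfun X),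
    natural (fun _ _ g => fmap (phi1 f) g) (fun _ _ g => fmap (phi f) g)
            (@phi1_incl X f);
  phi1_exact : forall (X : cspace R) (f : holfun X), exact_functor (phi1 f);
  phi1P : forall (X : cspace R) (f : holfun X) (M : MHM X),
    exists m0 : nat, forall m, (m0 <= m)%N ->
      is_kernel (fmap (rat_of (fiber f 0)) (phi1_incl f M))
                (epow (mono_T f M - idm _) m);

  (* N : phi_{f,1} -> phi_{f,1}(-1) is log T_u, where T_u = T on phi_{f,1}. *)
  logN : forall (X : cspace R) (f : holfun X) (M : MHM X),
    Mor (phi1 f M) (tw_neg (tate (fiber f 0)) (phi1 f M));
  logN_nat : forall (X : cspace R) (f : holfun X),
    natural (fun _ _ g => fmap (phi1 f) g)
            (fun _ _ g => fmap (tw_neg (tate (fiber f 0))) (fmap (phi1 f) g))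
            (@logN X f);
  logNP : forall (X : cspace R) (f : holfun X) (M : MHM X),
    exists (t : Mor (rat_of (fiber f 0) (phi1 f M))
                    (rat_of (fiber f 0) (phi1 f M))) (m : nat),
      [/\ fmap (rat_of (fiber f 0)) (phi1_incl f M) \oc t =
            mono_T f M \oc fmap (rat_of (fiber f 0)) (phi1_incl f M),
          epow (t - idm _) m = 0
        & rat_tw (phi1 f M) \oc fmap (rat_of (fiber f 0)) (logN f M) =
            log_trunc t m]
}.

Section Hodge.
Variables (R : realType) (H : mhm_theory R).

Definition Gr (X : fspace R) (k : int) (M : MHM H X) : MHM H X :=
  Coker (W_step k M).
Definition Gr_proj (X : fspace R) (k : int) (M : MHM H X) :
    Mor (W H X k M) (Gr k M) :=
  cokerm (W_step k M).

Definition shiftn (X : fspace R) (n : nat) (K : Db H X) : Db H X :=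
  iter n (shift H X) K.

(* [Nk k] is the map Gr^W_k M -> (Gr^W_{k-2} M)(-1) induced by
   N : M -> M(-1); it is unique, the projection being an epimorphism. *)
Definition graded_of (X : fspace R) (M : MHM H X)
    (N : Mor M (tw_neg (tate H X) M))
    (Nk : forall k, Mor (Gr k M) (tw_neg (tate H X) (Gr (k - 2) M))) : Prop :=
  forall k,
    Nk k \oc Gr_proj k M =
    fmap (tw_neg (tate H X)) (Gr_proj (k - 2) M) \oc
      (W_tw k M \oc fmap (W H X k) N).

(* {}^pH^j Q_X -> {}^pH^j Q_Y *)
Definition restrH (X : cspace R) (f : holfun X) (j : int) :
    Mor (pH H X j (QQ H X)) (push H f (pH H (fiber f 0) j (QQ H (fiber f 0)))) :=
  pH_push j (QQ H (fiber f 0)) \oc fmap (pH H X j) (restr H f).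

(* {}^pH^0 (Q_X[n]) *)
Definition pH0Q (X : fspace R) (n : nat) : MHM H X :=
  pH H X 0 (shiftn n (QQ H X)).

(* The decomposition V = V' \oplus V''.  Objects on Y are compared with objects
   on X through the direct image by the embedding of Y. *)
Definition vanishing_decomposition (X : cspace R) (f : holfun X) (n : nat)
    (V V' V'' : Ngraded (tate H (fiber f 0))) : Prop :=
  [/\ N_direct_sum V V' V'',
      hard_lefschetz V' n%:Z,
      hard_lefschetz V'' (n%:Z - 1),
      forall k : int, k <= n%:Z ->
        isomorphic (push H f (KerN V' k))
          (tw_neg (tate H X) (Gr (k - 2) (Coker (restrH f (n%:Z - 1)))))
    & forall k : int, k <= n%:Z - 1 ->
        isomorphic (push H f (KerN V'' k)) (Gr k (pH H X n%:Z (QQ H X)))].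

End Hodge.

(* Main.v *)
(** Shift so that the top degree [t] of V is far above j.  Pulling the twists
  together, N becomes a sequence of untwisted maps U_0 -> U_1 -> ..., with
  U_i = V_{t-2i}(-i), U_0 = 0 and U_a -> U_b an isomorphism when a + b = t - c.
  If y \oc x is invertible then the target of x is the direct sum of Ker y and
  the source of x; with x : U_m -> U_{m+1} and y : U_{m+1} -> U_{t-c-m} this
  splits off one primitive part at a time in degrees >= c, and the degrees < c
  follow from hard Lefschetz.  The result is carried back to V_j by the
  equivalence M |-> M(-i).  Finiteness of the weight filtration provides the
  top degree. *)
Require Import Defs.
From HB Require Import structures.
From mathcomp Require Import all_boot all_order all_algebra complex.
From mathcomp Require Import all_classical all_reals all_analysis.
From mathcomp Require Import zify.
Import Order.TTheory GRing.Theory Num.Theory.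
Import numFieldNormedType.Exports.
Local Open Scope classical_set_scope.
Local Open Scope ring_scope.

Set Implicit Arguments.
Unset Strict Implicit.

Local Notation compA := Defs.compA.
Local Notation fmap := Defs.fmap.

(** * Isomorphisms, kernels and subobjects in a Q-linear category *)

Section Category.
Variable C : category.
Implicit Types a b c d z : C.

Lemma compDl a b c (f : Mor a b) (g g' : Mor b c) :
  (g + g') \oc f = g \oc f + g' \oc f.
Proof. by have := comp_linl f 1 g g'; rewrite !scale1r. Qed.

Lemma compDr a b c (g : Mor b c) (f f' : Mor a b) :
  g \oc (f + f') = g \oc f + g \oc f'.
Proof. by have := comp_linr g 1 f f'; rewrite !scale1r. Qed.

Lemma comp0m a b c (f : Mor a b) : (0 : Mor b c) \oc f = 0.
Proof. by apply: (addrI (0 \oc f)); rewrite -compDl !addr0. Qed.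

Lemma compm0 a b c (g : Mor b c) : g \oc (0 : Mor a b) = 0.
Proof. by apply: (addrI (g \oc 0)); rewrite -compDr !addr0. Qed.

Lemma compNl a b c (f : Mor a b) (g : Mor b c) : (- g) \oc f = - (g \oc f).
Proof. by apply: (addrI (g \oc f)); rewrite -compDl !subrr comp0m. Qed.

Lemma compNr a b c (g : Mor b c) (f : Mor a b) : g \oc (- f) = - (g \oc f).
Proof. by apply: (addrI (g \oc f)); rewrite -compDr !subrr compm0. Qed.

Lemma zero_dom_eq a b (f g : Mor a b) : is_zero a -> f = g.
Proof. by move=> a0; rewrite -[f]compm1 -[g]compm1 a0 !compm0. Qed.

Lemma zero_cod_eq a b (f g : Mor a b) : is_zero b -> f = g.
Proof. by move=> b0; rewrite -[f]comp1m -[g]comp1m b0 !comp0m. Qed.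

Lemma mono_zero a b (f : Mor a b) : is_mono f -> is_zero b -> is_zero a.
Proof. by move=> fm b0; apply: fm; apply: zero_cod_eq. Qed.

Lemma iso_id a : is_iso (idm a).
Proof. by exists (idm a); rewrite comp1m. Qed.

Lemma iso_comp a b c (g : Mor b c) (f : Mor a b) :
  is_iso g -> is_iso f -> is_iso (g \oc f).
Proof.
move=> [g' [g'g gg']] [f' [f'f ff']]; exists (f' \oc g'); split.
- by rewrite compA -(compA f') g'g compm1.
- by rewrite compA -(compA g) ff' compm1.
Qed.

Lemma iso_mono a b (f : Mor a b) : is_iso f -> is_mono f.
Proof.
move=> [f' [f'f _]] z g h fgh.
by rewrite -[g]comp1m -[h]comp1m -f'f -!compA fgh.
Qed.

Lemma iso_epi a b (f : Mor a b) : is_iso f -> is_epi f.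
Proof.
move=> [f' [_ ff']] z g h fgh.
by rewrite -[g]compm1 -[h]compm1 -ff' !compA fgh.
Qed.

Lemma iso_cancell a b c (g : Mor b c) (f : Mor a b) :
  is_iso g -> is_iso (g \oc f) -> is_iso f.
Proof.
move=> [g' [g'g gg']] gfi.
rewrite -[f]comp1m -g'g -compA; apply: iso_comp => //.
by exists g.
Qed.

Lemma mono_comp a b c (g : Mor b c) (f : Mor a b) :
  is_mono g -> is_mono f -> is_mono (g \oc f).
Proof. by move=> gm fm z x y; rewrite -!compA => /gm /fm. Qed.

Lemma mono_cancel a b c (g : Mor b c) (f : Mor a b) :
  is_mono (g \oc f) -> is_mono f.
Proof. by move=> gfm z x y fxy; apply: gfm; rewrite -!compA fxy. Qed.

Lemma kernel_mono k a b (i : Mor k a) (f : Mor a b) :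
  is_kernel i f -> is_mono i.
Proof.
move=> [fi0 iP] z g h igh.
have [|x [_ xu]] := iP z (i \oc h); first by rewrite compA fi0 comp0m.
by rewrite -(xu h) // (xu g).
Qed.

Lemma same_subobject_refl a c (i : Mor a c) : same_subobject i i.
Proof. by exists (idm a); [exact: iso_id | rewrite compm1]. Qed.

Lemma same_subobject_sym a b c (i : Mor a c) (j : Mor b c) :
  same_subobject i j -> same_subobject j i.
Proof.
move=> [u [v [vu uv]] <-]; exists v; first by exists u.
by rewrite -compA uv compm1.
Qed.

Lemma same_subobject_trans a b d c (i : Mor a c) (j : Mor b c) (k : Mor d c) :
  same_subobject i j -> same_subobject j k -> same_subobject i k.
Proof.
move=> [u ui <-] [v vi <-]; exists (v \oc u); first exact: iso_comp.
by rewrite compA.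
Qed.

Lemma same_subobject_compl a b c d (h : Mor c d) (i : Mor a c) (j : Mor b c) :
  same_subobject i j -> same_subobject (h \oc i) (h \oc j).
Proof. by move=> [u ui <-]; exists u => //; rewrite compA. Qed.

Lemma same_subobject_mono a b c (i : Mor a c) (j : Mor b c) :
  same_subobject i j -> is_mono j -> is_mono i.
Proof. by move=> [u ui <-] jm; apply: mono_comp => //; apply: iso_mono. Qed.

Lemma kernel_same_subobject a b c d (i : Mor a c) (j : Mor b c) (f : Mor c d) :
  is_kernel i f -> is_kernel j f -> same_subobject i j.
Proof.
move=> ik jk; have im := kernel_mono ik; have jm := kernel_mono jk.
case: ik jk => [fi iP] [fj jP].
have [u [ju _]] := jP _ _ fi; have [v [iv _]] := iP _ _ fj.
exists u => //; exists v; split.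
- by apply: im; rewrite compA iv ju compm1.
- by apply: jm; rewrite compA ju iv compm1.
Qed.

Lemma kernel_mono_comp k a b c (i : Mor k a) (f : Mor a b) (g : Mor b c) :
  is_mono g -> is_kernel i (g \oc f) -> is_kernel i f.
Proof.
move=> gm [fi iP]; split; first by apply: gm; rewrite compA fi compm0.
by move=> z h fh; apply: iP; rewrite -compA fh compm0.
Qed.

Lemma kernel_comp_iso k a b c (i : Mor k a) (g : Mor b c) (f : Mor a b) :
  is_iso f -> is_kernel i (g \oc f) -> is_kernel (f \oc i) g.
Proof.
move=> fiso; have fm := iso_mono fiso; case: fiso => f' [f'f ff'] [gfi iP].
split; first by rewrite compA.
move=> z h gh; have [|x [ix xu]] := iP z (f' \oc h).
  by rewrite -compA (compA f) ff' comp1m.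
exists x; split; first by rewrite -compA ix compA ff' comp1m.
by move=> y fiy; apply: xu; apply: fm; rewrite !compA ff' fiy comp1m.
Qed.

(** If w inverts y x, then x w y is an idempotent with kernel Ker y and the image of x. The
    projections are p = w y onto the source of x and r, the factorization of 1 - x p through Ker
    y. *)
Lemma kernel_split q a b d (i : Mor q b) (x : Mor a b) (y : Mor b d) :
  is_kernel i y -> is_iso (y \oc x) ->
  forall z (g : Mor q z) (g' : Mor a z),
    exists! h : Mor b z, h \oc i = g /\ h \oc x = g'.
Proof.
move=> ik [w [wyx yxw]] z g g'; have im := kernel_mono ik.
case: ik => yi iP; set p := w \oc y.
have px : p \oc x = idm a by rewrite /p -compA.
have pi : p \oc i = 0 by rewrite /p -compA yi compm0.
have [|r [ir _]] := iP _ (idm b - x \oc p).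
  by rewrite compDr compNr compm1 /p !compA yxw comp1m subrr.
clearbody p.
have ri : r \oc i = idm q.
  apply: im; rewrite compA ir compDl comp1m compNl -compA pi compm0 subr0.
  by rewrite compm1.
have rx : r \oc x = 0.
  by apply: im; rewrite compA ir compDl comp1m compNl -compA px !compm1 subrr compm0.
exists (g \oc r + g' \oc p); split; first split.
- by rewrite compDl -!compA ri pi compm1 compm0 addr0.
- by rewrite compDl -!compA rx px compm1 compm0 add0r.
- move=> h [<- <-]; rewrite -!compA -compDr ir.
  by rewrite subrK compm1.
Qed.

End Category.

(** * Linear functors, and what fully faithful ones reflect *)

Section FunctorTheory.
Variables (C D : category) (F : functor C D).
Implicit Types a b c : C.

Lemma fmap0 a b : fmap F (0 : Mor a b) = 0.
Proof.
have := fmap_lin F 1 (0 : Mor a b) 0; rewrite !scale1r addr0 => e.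
by apply: (addrI (fmap F (0 : Mor a b))); rewrite addr0 -e.
Qed.

Lemma fmap_iso a b (f : Mor a b) : is_iso f -> is_iso (fmap F f).
Proof. by move=> [g [gf fg]]; exists (fmap F g); rewrite -!fmapM gf fg !fmap1. Qed.

Lemma fmap_zero a : is_zero a -> is_zero (F a).
Proof. by rewrite /is_zero -fmap1 => ->; exact: fmap0. Qed.

Lemma fmap_same_subobject a b c (i : Mor a c) (j : Mor b c) :
  same_subobject i j -> same_subobject (fmap F i) (fmap F j).
Proof.
by move=> [u ui <-]; exists (fmap F u); [exact: fmap_iso | rewrite fmapM].
Qed.

Hypothesis Fff : fully_faithful F.

Lemma ff_reflect_iso a b (f : Mor a b) : is_iso (fmap F f) -> is_iso f.
Proof.
case: Fff => Ffaith Ffull [g' [gf fg]]; have [g gE] := Ffull _ _ g'.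
by exists g; split; apply: Ffaith; rewrite fmapM gE fmap1.
Qed.

Lemma ff_reflect_same_subobject a b c (i : Mor a c) (j : Mor b c) :
  same_subobject (fmap F i) (fmap F j) -> same_subobject i j.
Proof.
case: (Fff) => Ffaith Ffull [u' ui e]; have [u uE] := Ffull _ _ u'.
exists u; first by apply: ff_reflect_iso; rewrite uE.
by apply: Ffaith; rewrite fmapM uE.
Qed.

(** Essential surjectivity is what lets an arbitrary test object of [D] be replaced by one coming
    from [C]. *)
Lemma ff_kernel k a b (i : Mor k a) (f : Mor a b) :
  (forall z : D, exists z' : C, isomorphic (F z') z) ->
  is_kernel i f -> is_kernel (fmap F i) (fmap F f).
Proof.
case: Fff => Ffaith Ffull Fsurj [fi iP]; split; first by rewrite -fmapM fi fmap0.
move=> z g fg; have [z' [v viso]] := Fsurj z.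
have vepi := iso_epi viso; case: viso => v' [v'v vv'].
have [g' g'E] := Ffull _ _ (g \oc v).
have [|h [ih hu]] := iP z' g'.
  by apply: Ffaith; rewrite fmapM g'E fmap0 compA fg comp0m.
exists (fmap F h \oc v'); split.
  by rewrite compA -fmapM ih g'E -compA vv' compm1.
move=> x ix; have [x' x'E] := Ffull _ _ (x \oc v).
rewrite (hu x'); first by rewrite x'E -compA vv' compm1.
by apply: Ffaith; rewrite fmapM x'E compA ix.
Qed.

End FunctorTheory.

(** * Images and cokernels in an abelian category *)

Section Abelian.
Variable A : abcat.

(** A monomorphism is the kernel of some g; since g factors through the cokernel of f, f is also the
    kernel of that cokernel. *)
Lemma mono_same_imm (a b : A) (f : Mor a b) : is_mono f ->
  same_subobject f (imm f).
Proof.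
move=> fm; apply: (@kernel_same_subobject _ _ _ _ _ _ _ (cokerm f)); last exact: kermP.
have [c [g [gf gP]]] := mono_normal fm.
case: (cokermP f) => pf pP; split=> // z x px; apply: gP.
by have [h [<- _]] := pP _ _ gf; rewrite -compA px compm0.
Qed.

Lemma coker_epi_zero (a b : A) (f : Mor a b) : is_epi f -> is_zero (Coker f).
Proof.
move=> fe; case: (cokermP f) => pf pP.
have p0 : cokerm f = 0 by apply: fe; rewrite pf comp0m.
have [|h [_ hu]] := pP _ (0 : Mor b (Coker f)); first exact: comp0m.
by apply: (etrans (esym (hu (idm _) _)) (hu 0 _)); rewrite p0 compm0.
Qed.

End Abelian.

(** * Primitive decomposition of a sequence of objects with a Lefschetz symmetry *)

(* Only [path i j] with i <= j matters, and [q a] with 2a <= s, where it is the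
   inclusion of the primitive part.  Families run over all a : nat, constrained
   afterwards, so that no dependent index type is needed. *)
Section Sequence.
Variables (C : category) (U : nat -> C) (path : forall i j, Mor (U i) (U j)).
Variables (s : nat) (Q : nat -> C) (q : forall a, Mor (Q a) (U a)).
Hypothesis U0 : is_zero (U 0%N).
Hypothesis path_id : forall i, path i i = idm (U i).
Hypothesis path_comp : forall i j k, (i <= j <= k)%N ->
  path j k \oc path i j = path i k.
Hypothesis path_iso : forall a b, (a + b = s)%N -> (a <= b)%N ->
  is_iso (path a b).
Hypothesis q_kernel : forall a b, (a + b = s.+1)%N -> (a <= b)%N ->
  is_kernel (q a) (path a b).

Lemma primitive_sum_upper m (z : C) : (m.*2 <= s)%N ->
  (forall g : forall a, Mor (Q a) z, exists h : Mor (U m) z,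
     forall a, (a <= m)%N -> h \oc (path a m \oc q a) = g a) /\
  (forall h h' : Mor (U m) z,
     (forall a, (a <= m)%N ->
        h \oc (path a m \oc q a) = h' \oc (path a m \oc q a)) -> h = h').
Proof.
elim: m => [|m IH] ms; split.
- move=> g; exists 0 => a; rewrite leqn0 => /eqP ->.
  apply: zero_dom_eq; apply: mono_zero U0; apply: kernel_mono.
  exact: (@q_kernel 0 s.+1).
- by move=> h h' _; apply: zero_dom_eq.
all: have [|IHe IHu] := IH; first by lia.
(* Take y to be the path from m + 1 to s - m. These indices add up to s + 1, so its kernel is
   primitive; starting from m they add up to s, so the composite with x is invertible. *)
all: have Qk : is_kernel (q m.+1) (path m.+1 (s - m)) by apply: q_kernel; lia.
all: have Si : is_iso (path m.+1 (s - m) \oc path m m.+1)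
  by rewrite path_comp; [apply: path_iso; lia | lia].
- move=> g; have [h hE] := IHe g.
  have [h' [[h'q h'x] _]] := kernel_split Qk Si (g m.+1) h.
  exists h' => a; rewrite leq_eqVlt ltnS => /orP[/eqP -> | am].
    by rewrite path_id comp1m.
  rewrite -(@path_comp a m m.+1); last by lia.
  by rewrite -compA compA h'x hE.
- move=> h h' e.
  have [x [_ xu]] := kernel_split Qk Si (h' \oc q m.+1) (h' \oc path m m.+1).
  rewrite -(xu h') //; apply/esym; apply: xu; split.
    by have := e m.+1 (leqnn _); rewrite path_id comp1m.
  apply: IHu => a am; have := e a (leqW am).
  rewrite -(@path_comp a m m.+1); last by lia.
  by rewrite -!compA.
Qed.

(** Past the middle, U_B is isomorphic to its mirror image U_{s-B}. The conditions on a say exactly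
    a <= min(B, s - B), so the sum is the one already found there. *)
Lemma primitive_sum B (z : C) : (B <= s)%N ->
  (forall g : forall a, Mor (Q a) z, exists h : Mor (U B) z,
     forall a, (a <= B)%N -> (a + B <= s)%N ->
       h \oc (path a B \oc q a) = g a) /\
  (forall h h' : Mor (U B) z,
     (forall a, (a <= B)%N -> (a + B <= s)%N ->
        h \oc (path a B \oc q a) = h' \oc (path a B \oc q a)) -> h = h').
Proof.
move=> Bs; pose m := minn B (s - B).
have mB : (m <= B)%N by lia.
have Mi : is_iso (path m B).
  have [e|e] : m = B \/ (m + B)%N = s by lia.
    by rewrite e path_id; apply: iso_id.
  by apply: path_iso.
have [|se su] := @primitive_sum_upper m z; first by lia.
have pE a : (a <= m)%N -> path a B = path m B \oc path a m.
  by move=> am; rewrite path_comp ?am.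
have Me := iso_epi Mi; case: Mi => w [wM Mw].
split=> [g | h h' e].
  have [h hE] := se g; exists (h \oc w) => a aB aBs.
  rewrite pE; last by lia.
  by rewrite -(compA h) !compA -(compA h w) wM compm1 -compA hE //; lia.
apply: Me; apply: su => a am; rewrite -!compA !(compA (path m B)) -pE //.
by apply: e; lia.
Qed.

End Sequence.

(** * Tate twists as equivalences of categories *)

Section Twist.
Variables (A : abcat) (T : tate_twist A).
Local Notation tn := (tw_neg T).
Local Notation tp := (tw_pos T).

Lemma tw_neg_faithful : faithful tn.
Proof.
move=> a b f g e; apply: (iso_epi (tw_pn_iso T a)).
by have := tw_pn_nat T f; rewrite e (tw_pn_nat T g).
Qed.

Lemma tw_pos_faithful : faithful tp.
Proof.
move=> a b f g e; apply: (iso_epi (tw_np_iso T a)).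
by have := tw_np_nat T f; rewrite e (tw_np_nat T g).
Qed.

Lemma tw_neg_ff : fully_faithful tn.
Proof.
split; first exact: tw_neg_faithful.
move=> a b h; have [p [p1 p2]] := tw_pn_iso T a.
(* The preimage of h is h(1) conjugated by M(-1)(1) = M; that its twist is h is checked after
   applying (1), where naturality of [tw_pn] is available. *)
exists (tw_pn T b \oc fmap tp h \oc p); apply: tw_pos_faithful.
apply: (iso_mono (tw_pn_iso T b)); rewrite tw_pn_nat.
by rewrite -!compA p1 compm1.
Qed.

Lemma tw_neg_kernel (k a b : A) (i : Mor k a) (f : Mor a b) :
  is_kernel i f -> is_kernel (fmap tn i) (fmap tn f).
Proof.
apply: ff_kernel; first exact: tw_neg_ff.
by move=> z; exists (tp z); exists (tw_np T z); exact: tw_np_iso.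
Qed.

(* No triangle identity relates [tw_pn] and [tw_np], so M(-1) -> M(-1)(1)(-1)
   -> M(-1) need not be the identity; being natural, it preserves subobjects. *)
Lemma tw_neg_adjunct (P M : A) (g : Mor P (tn M)) :
  same_subobject (fmap tn (tw_pn T M \oc fmap tp g)) g.
Proof.
have npi := tw_np_iso T P; case: (npi) => v [v1 v2].
(* Replacing P by P(1)(-1) turns g into a twist of some g', to which naturality of [tw_pn]
   applies. *)
have [g' g'E] := tw_neg_ff.2 _ _ (g \oc tw_np T P).
have gE : g = fmap tn g' \oc v by rewrite g'E -compA v2 compm1.
have vi : is_iso v by exists (tw_np T P).
have sg : same_subobject g (fmap tn g') by exists v.
apply: same_subobject_trans (same_subobject_sym sg).
apply: fmap_same_subobject; exists (tw_pn T _ \oc fmap tp v).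
  by apply: iso_comp; [exact: tw_pn_iso | exact: fmap_iso].
by rewrite gE fmapM !compA; have /= <- := tw_pn_nat T g'.
Qed.

Fixpoint twn_map (i : nat) (M M' : A) (f : Mor M M') :
    Mor (twn T i M) (twn T i M') :=
  match i return Mor (twn T i M) (twn T i M') with
  | 0 => f
  | i'.+1 => fmap tn (twn_map i' f)
  end.

Lemma twn_mapM i (a b c : A) (g : Mor b c) (f : Mor a b) :
  twn_map i (g \oc f) = twn_map i g \oc twn_map i f.
Proof. by elim: i => //= i ->; rewrite fmapM. Qed.

Lemma twn_map_faithful i (a b : A) (f g : Mor a b) :
  twn_map i f = twn_map i g -> f = g.
Proof. by elim: i => //= i IH /tw_neg_faithful. Qed.

Lemma twn_map_full i (a b : A) (g : Mor (twn T i a) (twn T i b)) :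
  exists f, twn_map i f = g.
Proof.
elim: i g => [|i IH] g /=; first by exists g.
have [g' <-] := tw_neg_ff.2 _ _ g; have [f <-] := IH g'.
by exists f.
Qed.

Lemma twn_map_reflect_mono i (a b : A) (f : Mor a b) :
  is_mono (twn_map i f) -> is_mono f.
Proof.
move=> fm z g h e; apply: (@twn_map_faithful i); apply: fm.
by rewrite -!twn_mapM e.
Qed.

Lemma twn_map_same_subobject i (a b c : A) (f : Mor a c) (g : Mor b c) :
  same_subobject f g -> same_subobject (twn_map i f) (twn_map i g).
Proof. by elim: i => //= i IH /IH; apply: fmap_same_subobject. Qed.

Lemma twn_map_reflect_same_subobject i (a b c : A) (f : Mor a c) (g : Mor b c) :
  same_subobject (twn_map i f) (twn_map i g) -> same_subobject f g.
Proof.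
elim: i => //= i IH /(ff_reflect_same_subobject tw_neg_ff); exact: IH.
Qed.

Lemma twp_mapM i (a b c : A) (g : Mor b c) (f : Mor a b) :
  twp_map T i (g \oc f) = twp_map T i g \oc twp_map T i f.
Proof. by elim: i a b c g f => //= i IH a b c g f; rewrite fmapM IH. Qed.

Lemma twp_zero i (a : A) : is_zero a -> is_zero (twp T i a).
Proof. by elim: i a => //= i IH a a0; apply: IH; apply: fmap_zero. Qed.

(** [NPrim_map] is built by twisting up by (i); twisted back by (-i), it becomes N^i on the
    primitive part, as a subobject. *)
Lemma untwist_adjunct i (P M : A) (g : Mor P (twn T i M)) :
  same_subobject (twn_map i (untwist T i M \oc twp_map T i g)) g.
Proof.
elim: i P g => [|i IH] P g /=; first by rewrite comp1m; apply: same_subobject_refl.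
rewrite -compA -twp_mapM; apply: same_subobject_trans (tw_neg_adjunct g).
exact: fmap_same_subobject.
Qed.

(** * Unrolling a graded object with N into a sequence of untwisted maps *)

Section Graded.
Variable V : Ngraded T.

(* V_{t-2i}(-i) *)
Fixpoint unrolled (i : nat) (t : int) : A :=
  if i is i'.+1 then tn (unrolled i' (t - 2)) else V t.

(* N^{j-i} : V_{t-2i}(-i) -> V_{t-2j}(-j), with junk value 0 for i > j. *)
Fixpoint unrolled_path (j i : nat) (t : int) :
    Mor (unrolled i t) (unrolled j t) :=
  match j, i return Mor (unrolled i t) (unrolled j t) with
  | 0, 0 => idm (V t)
  | 0, _.+1 => 0
  | j'.+1, 0 => fmap tn (unrolled_path j' 0 (t - 2)) \oc gN V t
  | j'.+1, i'.+1 => fmap tn (unrolled_path j' i' (t - 2))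
  end.

(** [unrolled] reaches degree t - 2i by repeated subtraction, so paths compose without transports;
    all degree equalities are confined to this comparison. *)
Fixpoint unrolled_twn (i : nat) : forall t j : int,
    t - i.*2%:Z = j -> Mor (unrolled i t) (twn T i (V j)) :=
  match i return forall t j : int,
    t - i.*2%:Z = j -> Mor (unrolled i t) (twn T i (V j)) with
  | 0 => fun t j e => transport V (etrans (esym (subr0 t)) e)
  | i'.+1 => fun t j e => fmap tn (unrolled_twn (shift_step e))
  end.

Lemma unrolled_twn_iso i t j (e : t - i.*2%:Z = j) : is_iso (unrolled_twn e).
Proof.
elim: i t j e => [|i IH] t j e /=; last exact: fmap_iso.
by case: _ / (etrans _ _); exact: iso_id.
Qed.

Lemma NpowE i t j (e : t - i.*2%:Z = j) :
  Npow V e = unrolled_twn e \oc unrolled_path i 0 t.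
Proof.
elim: i t j e => [|i IH] t j e /=; first by rewrite compm1.
by rewrite IH fmapM compA.
Qed.

Lemma unrolled_path_id i t : unrolled_path i i t = idm _.
Proof. by elim: i t => //= i IH t; rewrite IH fmap1. Qed.

Lemma unrolled_path_comp i j k t : (i <= j <= k)%N ->
  unrolled_path k j t \oc unrolled_path j i t = unrolled_path k i t.
Proof.
elim: k i j t => [|k IH] [|i] [|j] t //=; rewrite ?compm1 //.
- by rewrite comp0m.
- by move=> jk; rewrite compA -fmapM; congr (fmap tn _ \oc _); exact: (IH 0%N j).
- by move=> ijk; rewrite -fmapM IH.
Qed.

(** The path from i to i + 1 is N on V_j twisted by (-i), and twisting preserves kernels. *)
Lemma unrolled_path_Nkernel i t j (e : t - i.*2%:Z = j) (K : A)
    (f : Mor K (V j)) : is_kernel f (gN V j) ->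
  exists2 f' : Mor (twn T i K) (unrolled i t),
    is_kernel f' (unrolled_path i.+1 i t) & twn_map i f = unrolled_twn e \oc f'.
Proof.
move=> fk; elim: i t e => [|i IH] t e.
  move=> /=; move: (etrans _ _) => e'; case: _ / e' in f fk *.
  exists f; last by rewrite comp1m.
  by rewrite fmap1 comp1m.
have [f' f'k f'E] := IH _ (shift_step e).
exists (fmap tn f'); first exact: tw_neg_kernel.
by rewrite /= f'E fmapM.
Qed.

(** * Primitive parts, Ker N and the Lefschetz decomposition about the centre c *)

Section Primitive.
Variable c : int.

Lemma Prim_incl_kernel k :
  is_kernel (Prim_incl V c k) (unrolled_path k.+1 0 (c + k%:Z)).
Proof.
have : is_kernel (Prim_incl V c k) (@Npow _ _ V k.+1 (c + k%:Z) _ erefl) := kermP _.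
rewrite NpowE.
by apply: kernel_mono_comp; apply: iso_mono; exact: unrolled_twn_iso.
Qed.

(** The two degree equations force t = c + k + 2a: the primitive part of degree c + k enters the
    sequence at position a, twisted by (-a). Each step of the induction on a adds one twist. *)
Lemma NPrim_unrolled k i j (e : c + k%:Z - i.*2%:Z = j) a t
    (e' : t - (a + i).*2%:Z = j) :
  exists (K : A) (q : Mor K (unrolled a t)),
    is_kernel q (unrolled_path (a + k.+1) a t) /\
    same_subobject (twn_map (a + i) (NPrim_map V e))
      (unrolled_twn e' \oc (unrolled_path (a + i) a t \oc q)).
Proof.
elim: a t e' => [|a IH] t e'.
  have tE : t = c + k%:Z by move: e e'; rewrite add0n; lia.
  rewrite tE in e' *; exists (Prim V c k), (Prim_incl V c k); split.
    exact: Prim_incl_kernel.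
  by rewrite compA -NpowE (eq_irrelevance e' e); exact: untwist_adjunct.
have [K [q [qk qs]]] := IH _ (shift_step e').
exists (tn K), (fmap tn q); split; first exact: tw_neg_kernel.
by rewrite /= -!fmapM; exact: fmap_same_subobject.
Qed.

Hypothesis HL : hard_lefschetz V c.

(** Position a has degree c + (b - a) and position b degree c - (b - a), so this path is a hard
    Lefschetz map twisted by (-a). *)
Lemma unrolled_path_iso a b s : (a + b = s)%N -> (a <= b)%N ->
  is_iso (unrolled_path b a (c + s%:Z)).
Proof.
elim: a b s => [|a IH] b s.
  (* [hard_lefschetz] covers only positive exponents; for s = 0 the path is the identity. *)
  rewrite add0n => -> _; have [->|s0] := posnP s.
    by rewrite unrolled_path_id; exact: iso_id.
  have := HL s0; rewrite NpowE; apply: iso_cancell.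
  exact: unrolled_twn_iso.
case: b => [|b] // ab lab /=; apply: fmap_iso.
have -> : c + s%:Z - 2 = c + (a + b)%N%:Z by lia.
by apply: IH.
Qed.

(** N^i is the first factor of N^k, which is invertible on V_{c+k}, so it is injective there. *)
Lemma NPrim_map_mono k i j (e : c + k%:Z - i.*2%:Z = j) : (i <= k)%N ->
  is_mono (NPrim_map V e).
Proof.
move=> ik; apply: (@twn_map_reflect_mono i).
apply: same_subobject_mono (untwist_adjunct _) _.
apply: mono_comp; last exact: kernel_mono (kermP _).
rewrite NpowE; apply: mono_comp; first by apply: iso_mono; exact: unrolled_twn_iso.
apply: (@mono_cancel _ _ _ _ (unrolled_path k i (c + k%:Z))).
have pc := @unrolled_path_comp 0 i k (c + k%:Z) ik; rewrite [X in is_mono X]pc.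
by apply: iso_mono; exact: (@unrolled_path_iso 0 k k).
Qed.

Lemma NPrim_incl_same k i j (e : c + k%:Z - i.*2%:Z = j) : (i <= k)%N ->
  same_subobject (NPrim_incl V e) (NPrim_map V e).
Proof.
by move=> ik; apply/same_subobject_sym/mono_same_imm/NPrim_map_mono.
Qed.

(** N^k is an isomorphism from V_{c+k} to V_{c-k}(-k) and carries Ker N^{k+1} onto the kernel of N,
    twisted by (-k). *)
Lemma KerN_NPrim (k : nat) :
  same_subobject (KerN_incl V (c - k%:Z)) (NPrim_incl V (sub_double c k)).
Proof.
apply: same_subobject_trans (same_subobject_sym (NPrim_incl_same _ (leqnn k))).
apply: (@twn_map_reflect_same_subobject k).
apply: same_subobject_trans (same_subobject_sym (untwist_adjunct _)).
have [f' f'k ->] := unrolled_path_Nkernel (sub_double c k) (kermP (gN V (c - k%:Z))).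
rewrite NpowE -compA; apply: same_subobject_compl.
apply: kernel_same_subobject f'k _; apply: kernel_comp_iso.
  exact: (@unrolled_path_iso 0 k k).
have pc := @unrolled_path_comp 0 k k.+1 (c + k%:Z) (leqnSn k).
by rewrite [X in is_kernel _ X]pc; exact: Prim_incl_kernel.
Qed.

(** In a fixed degree the exponent i determines k, so the summands can be indexed by positions a = B
    - i. *)
Lemma lefschetz_index_eq j (p p' : lefschetz_index c j) : li p = li p' -> p = p'.
Proof.
case: p p' => [k i ik e] [k' i' ik' e'] /= ii'.
have kk' : k = k' by lia.
by subst; congr LefschetzIndex; exact: eq_irrelevance.
Qed.

Lemma lefschetz_decomposition_bounded (t0 : int) :
  (forall k, t0 <= k -> is_zero (V k)) -> lefschetz_decomposition V c.
Proof.
move=> V0 j z g.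
(* Position B below the top degree t carries V_j(-B). The first summand of B gives t - c >= B, hence
   B <= s; the second gives t >= t0, hence U_0 = V_t = 0. *)
pose B := (`|c - j| + `|t0 - j|)%N; pose t := j + B.*2%:Z; pose s := `|t - c|%N.
have tE : t = c + s%:Z by lia.
have Bs : (B <= s)%N by lia.
have e : t - B.*2%:Z = j by lia.
have t0t : t0 <= t by lia.
clearbody s t B.
pose Q a := Ker (unrolled_path (s.+1 - a) a t).
pose q a : Mor (Q a) (unrolled a t) := kerm (unrolled_path (s.+1 - a) a t).
have qk a b : (a + b = s.+1)%N -> (a <= b)%N ->
    is_kernel (q a) (unrolled_path b a t).
  by move=> ab _; have -> : b = (s.+1 - a)%N by [lia]; exact: kermP.
have pi a b : (a + b = s)%N -> (a <= b)%N -> is_iso (unrolled_path b a t).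
  by rewrite tE; exact: unrolled_path_iso.
have [se su] := @primitive_sum _ (fun a => unrolled a t)
  (fun a b => unrolled_path b a t) s Q q (V0 t t0t) (unrolled_path_id^~ t)
  (fun i j k => @unrolled_path_comp i j k t) pi qk B (twn T B z) Bs.
(* The summand of index (k, i), twisted by (-B), is the contribution of position a = B - i, for
   which k = s - 2a. *)
have cmp a (p : lefschetz_index c j) : (a + li p)%N = B ->
    exists2 u : Mor (twn T B (NPrim V (l_deg p))) (Q a), is_iso u &
      unrolled_twn e \oc (unrolled_path B a t \oc q a) \oc u =
      twn_map B (NPrim_incl V (l_deg p)).
  move=> aB; subst B; have [K [r [rk rs]]] := NPrim_unrolled (l_deg p) e.
  suff [u ui uE] : same_subobject (twn_map (a + li p) (NPrim_incl V (l_deg p)))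
      (unrolled_twn e \oc (unrolled_path (a + li p) a t \oc q a)) by exists u.
  apply: same_subobject_trans (twn_map_same_subobject _ (NPrim_incl_same _ (li_le p))) _.
  apply: same_subobject_trans rs _; do 2![apply: same_subobject_compl].
  apply: kernel_same_subobject rk _; apply: qk; last by lia.
  by have := l_deg p; lia.
(* Indices with i > B have no position in the sequence, but then c + k = j + 2i exceeds t, where V
   vanishes. *)
have far (p : lefschetz_index c j) : (B < li p)%N -> is_zero (NPrim V (l_deg p)).
  move=> Bp; have [u ui _] := NPrim_incl_same (l_deg p) (li_le p).
  apply: mono_zero (iso_mono ui) _; apply: twp_zero.
  apply: mono_zero (kernel_mono (kermP _)) _; apply: V0.
  by have := l_deg p; lia.
have si := unrolled_twn_iso e.
(* At most one index sits at position a: its component of g is transported to Q a, and 0 is used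
   when there is none. *)
have gQ a : exists ga : Mor (Q a) (twn T B z),
    forall p, (a + li p)%N = B -> exists2 u,
      unrolled_twn e \oc (unrolled_path B a t \oc q a) \oc u =
        twn_map B (NPrim_incl V (l_deg p)) &
      ga \oc u = twn_map B (g p).
  have [[p0 ap0]|np] := pselect (exists p0 : lefschetz_index c j, (a + li p0)%N = B).
    have [u [v [vu uv]] uE] := cmp a p0 ap0.
    exists (twn_map B (g p0) \oc v) => p ap; have -> : p = p0.
      by apply: lefschetz_index_eq; lia.
    by exists u => //; rewrite -compA vu compm1.
  by exists 0 => p ap; case: np; exists p.
pose g' a := sval (cid (gQ a)); have g'P a := svalP (cid (gQ a)).
have [h' h'P] := se g'; case: (si) => w [wi _].
have [h hE] := twn_map_full (h' \oc w).
have hP p : h \oc NPrim_incl V (l_deg p) = g p.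
  have [pB|/far p0] := leqP (li p) B; last exact: zero_dom_eq.
  apply: (@twn_map_faithful B); rewrite twn_mapM hE.
  have [|u <- <-] := g'P (B - li p)%N p; first by lia.
  rewrite -[sval _]/(g' _) -h'P; first by rewrite !compA -(compA h') wi compm1.
    by lia.
  by have := li_le p; have := l_deg p; lia.
exists h; split=> // f fP; apply: (@twn_map_faithful B).
apply: (iso_epi si); apply: su => a aB aBs.
(* Conversely, each position a in range is that of the index i = B - a, k = s - 2a; the bound a + B
   <= s is the condition i <= k. *)
have ik : (B - a <= s - a.*2)%N by lia.
have pe : c + (s - a.*2)%N%:Z - (B - a).*2%:Z = j by lia.
pose p := LefschetzIndex ik pe.
have [|u ui uE] := cmp a p; first by rewrite /=; lia.
apply: (iso_epi ui).
have uEx (x : Mor (twn T B (V j)) (twn T B z)) :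
    x \oc unrolled_twn e \oc (unrolled_path B a t \oc q a) \oc u =
    x \oc twn_map B (NPrim_incl V (l_deg p)) by rewrite -uE !compA.
by rewrite !uEx -!twn_mapM hP fP.
Qed.

End Primitive.
End Graded.
End Twist.

(** * Boundedness of the weights, and the conclusion *)

Section Weights.
Variables (R : realType) (H : mhm_theory R).

(** Once W_{k-1} and W_k are both all of M, the step between them is invertible; the index k - 1
    accounts for the bound b + 1. *)
Lemma Gr_bounded (X : fspace R) (M : MHM H X) :
  exists b : int, forall k, b <= k -> is_zero (Gr k M).
Proof.
have [_ [b [_ bP]]] := W_finite M; exists (b + 1) => k bk.
apply/coker_epi_zero/iso_epi; apply: (@iso_cancell _ _ _ _ (W_incl k M)).
  by apply: bP; lia.
by rewrite W_stepE; apply: bP; lia.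
Qed.

End Weights.

Lemma biproduct_zero (C : category) (a b c : C) (i : Mor a c) (j : Mor b c) :
  is_biproduct i j -> is_zero c -> is_zero a /\ is_zero b.
Proof.
move=> [p [q [pi qj _ _ _]]] c0.
by split; [rewrite /is_zero -pi | rewrite /is_zero -qj];
  rewrite -[X in _ \oc X]comp1m c0 comp0m compm0.
Qed.

Theorem corollary2 (R : realType) (H : mhm_theory R)
  (X : cspace R) (n : nat) (f : holfun X)
  (embX : intersection_of_hypersurfaces X)
  (dimX : has_dim X n)
  (smooth_fibers : forall t : CC R, t != 0 -> smooth_pure (fiber f t) n.-1)
  (nonconstant : forall Z : set X, irreducible_component n Z ->
     exists x y, [/\ Z x, Z y & f x != f y])
  (smooth_compl : smooth_pure (induced_space [set x : X | f x != 0]) n)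
  (NV : forall k, Mor (Gr k (phi1 H f (pH0Q H X n)))
     (tw_neg (tate H (fiber f 0)) (Gr (k - 2) (phi1 H f (pH0Q H X n)))))
  (NV_induced : graded_of (logN f (pH0Q H X n)) NV)
  (V' V'' : Ngraded (tate H (fiber f 0)))
  (decomposition : vanishing_decomposition n (NGraded NV) V' V'') :
  [/\ lefschetz_decomposition V' n%:Z,
      lefschetz_decomposition V'' (n%:Z - 1),
      forall k : nat, same_subobject (KerN_incl V' (n%:Z - k%:Z))
                        (NPrim_incl V' (sub_double n%:Z k))
    & forall k : nat, same_subobject (KerN_incl V'' (n%:Z - 1 - k%:Z))
                        (NPrim_incl V'' (sub_double (n%:Z - 1) k))].
Proof.
case: decomposition => [[u' [u'' uP]] HL' HL'' _ _].
have [b bP] := Gr_bounded (phi1 H f (pH0Q H X n)).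
split.
(* The bound on the degrees of V passes to its direct summands. *)
- apply: (lefschetz_decomposition_bounded HL') => k /bP.
  by have [/biproduct_zero h _ _] := uP k; move=> /h [].
- apply: (lefschetz_decomposition_bounded HL'') => k /bP.
  by have [/biproduct_zero h _ _] := uP k; move=> /h [].
- exact: KerN_NPrim.
- exact: KerN_NPrim.
Qed.
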